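(* Let $\psi:\mathbb{T}^2\to\mathbb{R}$ be a non-constant real eigenfunction of the Laplacian on the flat two-dimensional torus $\mathbb{T}^2$. Then $$\operatorname{vol}(\{x\in\mathbb{T}^2:\psi(x)>0\})=\operatorname{vol}(\{x\in\mathbb{T}^2:\psi(x)<0\}).$$
   Context: $\mathbb{T}^2=\mathbb{R}^2/\mathbb{Z}^2$ is the standard flat torus and $\operatorname{vol}$ is Lebesgue measure on it. A real eigenfunction is a smooth function $\psi:\mathbb{T}^2\to\mathbb{R}$, not identically zero, with $-\Delta\psi=\mu\psi$ for some real $\mu$; equivalently, for some integer $\lambda\ge 0$, $\psi$ is a real-valued linear combination of the exponentials $\exp(2\pi i(\nu_1x+\nu_2y))$ with $\nu\in\mathbb{Z}^2$, $\nu_1^2+\nu_2^2=\lambda$. *)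

(* Defs.v *)
From HB Require Import structures.
From mathcomp Require Import all_boot all_order all_algebra generic_quotient.
From mathcomp Require Import all_classical all_reals all_analysis.

Set Implicit Arguments.
Unset Strict Implicit.
Unset Printing Implicit Defensive.

Import Order.TTheory GRing.Theory Num.Theory.
Import numFieldNormedType.Exports.

Local Open Scope classical_set_scope.
Local Open Scope ring_scope.
Local Open Scope quotient_scope.

Section Torus.
Variable R : realType.
Implicit Types (p q : R * R) (f : R * R -> R).

Definition lattice_rel p q : bool :=
  (p.1 - q.1 \is a Num.int) && (p.2 - q.2 \is a Num.int).

Lemma lattice_rel_refl : reflexive lattice_rel.
Proof. by move=> p; rewrite /lattice_rel !subrr !rpred0. Qed.

Lemma lattice_rel_sym : symmetric lattice_rel.
Proof.
by move=> p q; rewrite /lattice_rel -(opprB q.1) -(opprB q.2) !rpredN.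
Qed.

Lemma lattice_rel_trans : transitive lattice_rel.
Proof.
move=> q p r /andP[pq1 pq2] /andP[qr1 qr2]; apply/andP; split.
  by rewrite -(subrK q.1 p.1) -addrA rpredD.
by rewrite -(subrK q.2 p.2) -addrA rpredD.
Qed.

Canonical lattice_equiv :=
  EquivRel lattice_rel lattice_rel_refl lattice_rel_sym lattice_rel_trans.

Definition torus : Type := {eq_quot lattice_equiv}.

Definition torus_proj p : torus := \pi_({eq_quot lattice_equiv}) p.

(* [0, 1[ x [0, 1[ is a fundamental domain of the projection. *)
Definition torus_vol (A : set torus) : \bar R :=
  (lebesgue_measure \x lebesgue_measure)%E
    ((torus_proj @^-1` A) `&` (`[0, 1[ `*` `[0, 1[)).

Definition partial1 f : R * R -> R := fun p => 'D_(1, 0) f p.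

Definition partial2 f : R * R -> R := fun p => 'D_(0, 1) f p.

Fixpoint Ck (k : nat) f : Prop :=
  continuous f /\
  if k is k'.+1 then
    [/\ forall p, derivable f p (1, 0), forall p, derivable f p (0, 1),
        Ck k' (partial1 f) & Ck k' (partial2 f)]
  else True.

Definition smooth f : Prop := forall k, Ck k f.

Definition laplacian f : R * R -> R :=
  fun p => partial1 (partial1 f) p + partial2 (partial2 f) p.

(* The projection is a local isometry of flat surfaces, so smoothness and the
   Laplacian of psi are those of its lift to the plane. *)
Definition real_eigenfunction (psi : torus -> R) : Prop :=
  [/\ smooth (psi \o torus_proj),
      exists x, psi x <> 0
    & exists mu : R, forall p,
        - laplacian (psi \o torus_proj) p = mu * psi (torus_proj p)].

End Torus.

(* Main.v *)
Require Import Defs.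
From mathcomp Require Import all_boot all_order all_algebra generic_quotient.
From mathcomp Require Import all_classical all_reals all_analysis.
From mathcomp Require Import measurable_realfun.
From mathcomp Require Import ring lra zify.

(** The eigenfunction is antisymmetric under some translation of the torus:
    there is tau with psi (p + tau) = - psi p for every p.  As Lebesgue measure
    on the torus is translation invariant, the sets where psi is positive and
    where it is negative, being translates of each other, have equal volume.

    The translation comes from arithmetic.  If psi is not constant, its
    frequencies (n, m) all lie on one circle n^2 + m^2 = N with N > 0.  When N
    is odd, exactly one of n, m is odd and tau = (1/2, 1/2) works; when
    N = 2 mod 4, both are odd and tau = (1/2, 0) works; when 4 divides N, both
    are even, and half of a translation that works for N / 4 works for N
    ([half_shift]).

    That psi has only these frequencies is the Fourier part.  Integrating
    against the waves cos (2 pi n x + th) and cos (2 pi m y + et), with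
    arbitrary phases, gives real Fourier coefficients of the lift f of psi to
    the plane.  Two integrations by parts turn the eigenvalue equation into
    (4 pi^2 (n^2 + m^2) - mu) * coef = 0 ([eigen_coef]).  A translation of f
    only changes the phases of the waves ([coef_shift]), so every coefficient
    of f (p + tau) + f p vanishes, and this function is zero by the uniqueness
    theorem for Fourier coefficients ([coef_eq0]).  The latter reduces to one
    variable, where it is proved with the powers of a trigonometric polynomial
    that exceeds 1 only near a given point ([orthogonal_waves_center]). *)

Set Implicit Arguments.
Unset Strict Implicit.
Unset Printing Implicit Defensive.

Import Order.TTheory GRing.Theory Num.Theory.
Import numFieldNormedType.Exports.

Local Open Scope classical_set_scope.
Local Open Scope ring_scope.

(** * Translation invariance and integrals over a period *)

Lemma lebesgue_measure_shift (R : realType) (s : R) (A : set R) :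
  measurable A ->
  pushforward lebesgue_measure ((fun x => x + s) : R -> measurableTypeR R) A
    = lebesgue_measure A.
Proof.
move=> mA.
have ms : measurable_fun setT ((fun x => x + s) : R -> measurableTypeR R).
  exact: measurable_funD.
apply/esym/lebesgue_measure_unique => //= _ [[a b]] _ <-.
rewrite /pushforward.
have -> : (fun x : R => x + s) @^-1` `]a, b] = `](a - s), (b - s)]%classic.
  by apply/seteqP; split => x /=; rewrite !in_itv/= => /andP[? ?];
    apply/andP; split; lra.
rewrite !lebesgue_measure_itv/= !lte_fin ltrD2r.
by case: ifP => // _; rewrite -!EFinB; congr EFin; ring.
Qed.

Lemma ge0_integral_shift (R : realType) (s : R) (D : set R) (G : R -> \bar R) :
  measurable D -> measurable_fun [set: R] G -> (forall x, 0 <= G x)%E ->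
  (\int[lebesgue_measure]_(x in (fun x => x + s)%R @^-1` D) G (x + s)%R
   = \int[lebesgue_measure]_(x in D) G x)%E.
Proof.
move=> mD mG G0.
have ms : measurable_fun setT ((fun x => x + s) : R -> measurableTypeR R).
  exact: measurable_funD.
transitivity (\int[pushforward lebesgue_measure
    ((fun x => x + s)%R : R -> measurableTypeR R)]_(x in D) G x)%E.
  by rewrite ge0_integral_pushforward//=; exact: measurable_funS mG.
by apply: eq_measure_integral => //= A mA AS; exact: lebesgue_measure_shift.
Qed.

(** Functions on the line with period 1, stated with all integer translates. *)
Definition Zperiodic {R : realType} {T : Type} (G : R -> T) :=
  forall x (m : int), G (x + m%:~R) = G x.

(** For 0 <= s < 1 the interval [s, 1 + s[ is cut at 1, and its part beyond 1
    is moved back by one period. *)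
Lemma ge0_integral_periodic_shift (R : realType) (s : R) (G : R -> \bar R) :
  measurable_fun [set: R] G -> (forall x, 0 <= G x)%E -> Zperiodic G ->
  (\int[lebesgue_measure]_(x in `[0%R, 1%R[) G (x + s)%R
   = \int[lebesgue_measure]_(x in `[0%R, 1%R[) G x)%E.
Proof.
move=> mG G0 pG.
wlog s01 : s / 0 <= s < 1.
  move=> H; rewrite -(H (s - (Num.floor s)%:~R)).
    apply: eq_integral => x _.
    by rewrite -[in RHS](pG _ (Num.floor s)) -addrA subrK.
  have := floor_itv s; rewrite intrD.
  by move=> /andP[? ?]; apply/andP; split; lra.
have /andP[s0 s1] := s01.
have mGS D : measurable_fun D G by exact: measurable_funS mG.
have preim (r a b : R) :
    (fun x => x + r) @^-1` `[a, b[ = `[a - r, b - r[%classic.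
  by apply/seteqP; split => x /=; rewrite !in_itv/= => /andP[? ?];
    apply/andP; split; lra.
have -> : (\int[lebesgue_measure]_(x in `[0%R, 1%R[) G (x + s)%R =
    \int[lebesgue_measure]_(x in `[s, (1 + s)%R[) G x)%E.
  by rewrite -(@ge0_integral_shift _ s `[s, (1 + s)%R[)// preim subrr addrK.
have splt (a b c : R) : a <= b -> b <= c ->
    (\int[lebesgue_measure]_(x in `[a, c[) G x =
     \int[lebesgue_measure]_(x in `[a, b[) G x +
     \int[lebesgue_measure]_(x in `[b, c[) G x)%E.
  move=> ab bc; rewrite -ge0_integral_setU//; [|exact: mGS|]; last first.
    apply/disj_setPS => x /= []; rewrite !in_itv/= => /andP[_ ?] /andP[? _].
    by lra.
  suff -> : `[a, c[%classic = `[a, b[%classic `|` `[b, c[%classic by [].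
  apply/seteqP; split => x /=; rewrite !in_itv/=.
    by case: (ltP x b) => ? /andP[? ?]; [left|right]; apply/andP; split.
  by move=> [] /andP[? ?]; apply/andP; split; lra.
rewrite (splt s 1 (1 + s)); [|lra|lra].
rewrite (splt 0 s 1); [|lra|lra].
rewrite addeC; congr (_ + _)%E.
rewrite -(@ge0_integral_shift _ 1 `[1%R, (1 + s)%R[)// preim subrr (addrC 1 s).
rewrite addrK.
by apply: eq_integral => x _; exact: (pG x 1).
Qed.

Lemma integral_periodic_shift (R : realType) (s : R) (G : R -> \bar R) :
  measurable_fun [set: R] G -> Zperiodic G ->
  (\int[lebesgue_measure]_(x in `[0%R, 1%R[) G (x + s)%R
   = \int[lebesgue_measure]_(x in `[0%R, 1%R[) G x)%E.
Proof.
move=> mG pG; rewrite integralE [RHS]integralE; congr (_ - _)%E.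
- rewrite -[RHS](@ge0_integral_periodic_shift _ s)//.
  + by apply: eq_integral => x _; rewrite ?funeposE ?funenegE.
  + exact: measurable_funepos.
  + by move=> x m; rewrite !funeposE pG.
- rewrite -[RHS](@ge0_integral_periodic_shift _ s)//.
  + by apply: eq_integral => x _; rewrite ?funeposE ?funenegE.
  + exact: measurable_funeneg.
  + by move=> x m; rewrite !funenegE pG.
Qed.

(** The integral of a real function over one period. *)
Notation mean u := (\int[lebesgue_measure]_(x in `[0, 1]) u x)%R.

Lemma continuous_integrable01 (R : realType) (u : R -> R) : continuous u ->
  lebesgue_measure.-integrable `[0, 1] (EFin \o u).
Proof.
move=> cu; apply: continuous_compact_integrable; first exact: segment_compact.
exact: continuous_subspaceT.
Qed.

Lemma mean_shift (R : realType) (s : R) (u : R -> R) :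
  continuous u -> Zperiodic u -> mean (fun x => u (x + s)) = mean u.
Proof.
move=> cu pu.
have cus : continuous (fun x => u (x + s)).
  move=> x; apply: continuous_comp; last exact: cu.
  by apply: cvgD; [exact: cvg_id|exact: cvg_cst].
rewrite -!Rintegral_itv_bndo_bndc; last 2 first.
- apply: (integrableS _ _ _ (continuous_integrable01 cu)) => //.
  exact: subset_itv_co_cc.
- apply: (integrableS _ _ _ (continuous_integrable01 cus)) => //.
  exact: subset_itv_co_cc.
rewrite /Rintegral -(@integral_periodic_shift _ s (EFin \o u))//.
  by apply/measurable_EFinP; exact: continuous_measurable_fun.
by move=> x m /=; rewrite pu.
Qed.

(** * Uniqueness of Fourier coefficients in one variable *)

Section ContinuousOperations.
Context {T : topologicalType} {R : realType}.
Implicit Types u v : T -> R.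

Lemma continuousDf u v : continuous u -> continuous v ->
  continuous (fun x => u x + v x).
Proof. by move=> cu cv x; apply: cvgD; [exact: cu|exact: cv]. Qed.

Lemma continuousMf u v : continuous u -> continuous v ->
  continuous (fun x => u x * v x).
Proof. by move=> cu cv x; apply: cvgM; [exact: cu|exact: cv]. Qed.

Lemma continuous_cstf (c : R) : continuous (fun _ : T => c).
Proof. by move=> x; exact: cvg_cst. Qed.

Lemma continuousXf u n : continuous u -> continuous (fun x => u x ^+ n).
Proof.
move=> cu; elim: n => [|n IH]; first exact: continuous_cstf.
by under eq_fun do rewrite exprS; exact: continuousMf.
Qed.

Lemma continuous_cosf u : continuous u -> continuous (fun x => cos (u x)).
Proof.
by move=> cu x; apply: continuous_comp; [exact: cu|exact: continuous_cos].
Qed.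

End ContinuousOperations.

Lemma mean_lin (R : realType) (a b : R) (u v : R -> R) :
  continuous u -> continuous v ->
  mean (fun x => a * u x + b * v x) = a * mean u + b * mean v.
Proof.
move=> cu cv; rewrite RintegralD//; last 2 first.
- apply: continuous_integrable01; apply: continuousMf => //.
  exact: continuous_cstf.
- apply: continuous_integrable01; apply: continuousMf => //.
  exact: continuous_cstf.
by rewrite !RintegralZl//; exact: continuous_integrable01.
Qed.

(** The real wave of integer frequency n and phase th.  Letting the phase vary
    replaces the pair cosine, sine, and makes the family stable under
    translation and differentiation. *)
Definition wave {R : realType} (n : int) (th x : R) : R :=
  cos (2 * pi * n%:~R * x + th).

Lemma continuous_wave (R : realType) n (th : R) : continuous (wave n th).
Proof.
apply: continuous_cosf; apply: continuousDf; last exact: continuous_cstf.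
by apply: continuousMf; [exact: continuous_cstf|move=> x; exact: cvg_id].
Qed.

Lemma cosD2piz (R : realType) (x : R) (m : int) :
  cos (x + 2 * pi * m%:~R) = cos x.
Proof.
have H (y : R) (k : nat) : cos (y + 2 * pi * k%:R) = cos y.
  rewrite -[RHS](periodicn (@cosD2pi R) k); congr cos.
  by rewrite mulr_natr mulr_natl.
case: m => k; first exact: H.
rewrite NegzE mulrNz mulrN -[LHS](H _ k.+1); congr cos.
by rewrite subrK.
Qed.

Lemma wave_periodic (R : realType) n (th : R) : Zperiodic (wave n th).
Proof.
move=> x m; rewrite /wave -[RHS](cosD2piz _ (n * m)); congr cos.
by rewrite intrM; ring.
Qed.

Lemma wave_shift (R : realType) n (th x s : R) :
  wave n th (x + s) = wave n (th + 2 * pi * n%:~R * s) x.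
Proof. by rewrite /wave; congr cos; ring. Qed.

Lemma cos2pi_lt (R : realType) (a b : R) :
  0 <= a -> a < b -> b <= 2^-1 -> cos (2 * pi * b) < cos (2 * pi * a).
Proof.
move=> a0 ab b1; have pi0 := pi_gt0 R.
by rewrite ltr_cos ?in_itv/=; [nra|apply/andP; split; nra..].
Qed.

Lemma cos2pi_le (R : realType) (a b : R) :
  0 <= a -> a <= b -> b <= 2^-1 -> cos (2 * pi * b) <= cos (2 * pi * a).
Proof.
move=> a0; rewrite le_eqVlt => /predU1P[->//|ab] b1; exact/ltW/cos2pi_lt.
Qed.

(** A trigonometric polynomial that is at least 1 within distance d of 1/2 and
    has absolute value at most 1 on the rest of [0, 1] (for 0 < d < 1/2). *)
Definition peak {R : realType} (d x : R) : R :=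
  1 + cos (2 * pi * (x - 2^-1)) - cos (2 * pi * d).

Lemma continuous_peak (R : realType) (d : R) : continuous (peak d).
Proof.
apply: continuousDf; last exact: continuous_cstf.
apply: continuousDf; first exact: continuous_cstf.
apply: continuous_cosf; apply: continuousMf; first exact: continuous_cstf.
by apply: continuousDf; [move=> x; exact: cvg_id|exact: continuous_cstf].
Qed.

(** The product formula for cosines: multiplication by [peak d] preserves the
    linear span of the waves. *)
Lemma wave_peak (R : realType) n (th d x : R) :
  wave n th x * peak d x = (1 - cos (2 * pi * d)) * wave n th x
    + 2^-1 * (wave (n + 1) (th - pi) x + wave (n - 1) (th + pi) x).
Proof.
rewrite /wave /peak.
have -> : 2 * pi * (n + 1)%:~R * x + (th - pi)
    = (2 * pi * n%:~R * x + th) + 2 * pi * (x - 2^-1).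
  by rewrite intrD mulr1z; move: (n%:~R) (pi : R) => k p; field.
have -> : 2 * pi * (n - 1)%:~R * x + (th + pi)
    = (2 * pi * n%:~R * x + th) - 2 * pi * (x - 2^-1).
  by rewrite intrB mulr1z; move: (n%:~R) (pi : R) => k p; field.
rewrite (cosD (_ + th)) (cosB (_ + th)).
move: (cos (_ + th)) (sin (_ + th)) (cos (_ * (x - _))) (sin (_ * (x - _)))
  (cos (2 * pi * d)) => a b a' b' c.
by field.
Qed.

(** All Fourier coefficients of [u] vanish. *)
Definition orthogonal_waves {R : realType} (u : R -> R) :=
  forall n th, mean (fun x => u x * wave n th x) = 0.

Lemma orthogonal_peak (R : realType) (u : R -> R) (d : R) N :
  continuous u -> orthogonal_waves u ->
  orthogonal_waves (fun x => u x * peak d x ^+ N).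
Proof.
move=> cu ou; elim: N => [|N IH] n th.
  by rewrite -[RHS](ou n th); apply: eq_Rintegral => x _; rewrite expr0 mulr1.
pose w k t x := u x * peak d x ^+ N * wave k t x.
have cw k t : continuous (w k t).
  apply: continuousMf; last exact: continuous_wave.
  by apply: continuousMf => //; apply: continuousXf; exact: continuous_peak.
transitivity (mean (fun x => (1 - cos (2 * pi * d)) * w n th x
    + 2^-1 * (1 * w (n + 1) (th - pi) x + 1 * w (n - 1) (th + pi) x))).
  apply: eq_Rintegral => x _; rewrite /w exprSr mulrA -mulrA.
  by rewrite [peak d x * _]mulrC wave_peak; ring.
rewrite mean_lin//; last first.
  by apply: continuousDf; apply: continuousMf => //; exact: continuous_cstf.
by rewrite mean_lin// /w !IH; ring.
Qed.

Lemma bernoulli_inequality (R : realType) (q : R) N :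
  1 <= q -> 1 + N%:R * (q - 1) <= q ^+ N.
Proof.
move=> q1; elim: N => [|N IH]; first by rewrite expr0; lra.
rewrite exprS; have N0 : 0 <= N%:R :> R by exact: ler0n.
have H : q * (1 + N%:R * (q - 1)) <= q * q ^+ N by apply: ler_wpM2l => //; lra.
apply: le_trans H; rewrite -natr1.
have : 0 <= N%:R * (q - 1) ^+ 2 by rewrite mulr_ge0// sqr_ge0.
move: (N%:R : R) => k; nra.
Qed.

Lemma continuous_bounded01 (R : realType) (u : R -> R) : continuous u ->
  exists2 M : R, 0 <= M & forall x : R, x \in `[0, 1] -> `|u x| <= M.
Proof.
move=> cu.
have [c _ H] := @EVT_max R (fun x => `|u x|) 0 1 ler01 (continuous_subspaceT
  (fun x => continuous_comp (cu x) (@norm_continuous _ R (u x)))).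
by exists `|u c|.
Qed.

(** If [u (1/2)] were positive, the integrals of [u * peak d ^+ N], which all
    vanish, would grow geometrically with N because of the points close to 1/2,
    while the remaining points contribute a bounded amount. *)
Lemma orthogonal_waves_center (R : realType) (u : R -> R) :
  continuous u -> orthogonal_waves u -> u 2^-1 <= 0.
Proof.
move=> cu ou; rewrite leNgt; apply/negP => u0.
have [d [d0 d1 ud]] : exists d : R, [/\ 0 < d, d < 2^-1 &
    forall x : R, `|x - 2^-1| <= d -> u 2^-1 / 2 <= u x].
  have /cvgrPdist_lt/(_ (u 2^-1 / 2)) := cu 2^-1.
  have u20 : 0 < u 2^-1 / 2 by lra.
  move=> /(_ u20); rewrite -nbhs_nearE => /nbhs_ballP[e /= e0 He].
  exists (Num.min (e / 2) 4^-1); split.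
  - by rewrite lt_min; apply/andP; split; lra.
  - by rewrite gt_min; apply/orP; right; lra.
  - move=> x; rewrite le_min => /andP[xe _].
    have /He : ball (2^-1 : R) e x.
      by rewrite /ball/= distrC; apply: le_lt_trans xe _; lra.
    by rewrite ltr_norml => /andP[_]; lra.
have [M M0 HM] := continuous_bounded01 cu.
set q := peak d (2^-1 + d / 2).
have cosE x : cos (2 * pi * (x - 2^-1)) = cos (2 * pi * `|x - 2^-1|) :> R.
  case: (ger0P (x - 2^-1)) => // _; by rewrite mulrN cosN.
have q1 : 1 < q.
  rewrite /q /peak; have -> : 2^-1 + d / 2 - 2^-1 = d / 2 by field.
  by have := @cos2pi_lt R (d / 2) d; rewrite -subr_gt0; nra.
set c := u 2^-1 / 2 in ud *.
have c0 : 0 < c by rewrite /c; lra.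
pose I : set R := `[2^-1 - d / 2, 2^-1 + d / 2]%classic.
have mI : measurable I by exact: measurable_itv.
have I01 : I `<=` `[0, 1].
  by apply: subset_itv; rewrite bnd_simp; lra.
(* Within distance d of 1/2, u is positive and peak is at least 1; elsewhere
   |peak| <= 1 and |u| <= M. *)
have low N x : x \in `[0, 1] -> 0 <= u x * peak d x ^+ N + M.
  move=> x01; have := HM x x01; rewrite ler_norml => /andP[uM1 uM2].
  have := x01; rewrite in_itv/= => /andP[x0 x1].
  have [xd|dx] := leP `|x - 2^-1| d.
    have p1 : 1 <= peak d x.
      rewrite /peak cosE; have := @cos2pi_le R `|x - 2^-1| d.
      by move=> /(_ (normr_ge0 _) xd) H; have := H (ltW d1); lra.
    have := ud _ xd; have : 0 <= peak d x ^+ N by rewrite exprn_ge0//; lra.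
    by nra.
  have p1 : `|peak d x ^+ N| <= 1.
    rewrite normrX exprn_ile1// /peak cosE ler_norml.
    have := @cos2pi_le R d `|x - 2^-1| (ltW d0) (ltW dx).
    have x12 : `|x - 2^-1| <= 2^-1 by rewrite ler_norml; apply/andP; split; lra.
    move=> /(_ x12).
    have := cos_geN1 (2 * pi * `|x - 2^-1|).
    have := cos_le1 (2 * pi * d).
    by move=> *; apply/andP; split; lra.
  have : `|u x * peak d x ^+ N| <= M.
    rewrite normrM -[leRHS]mulr1; apply: ler_pM => //; exact: HM.
  by rewrite ler_norml => /andP[]; lra.
have high N x : x \in I -> c * q ^+ N <= u x * peak d x ^+ N + M.
  rewrite inE /I /= in_itv/= => /andP[x1 x2].
  have xd : `|x - 2^-1| <= d / 2 by rewrite ler_norml; apply/andP; split; lra.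
  have qp : q <= peak d x.
    rewrite /q /peak [in leRHS]cosE; have -> : 2^-1 + d / 2 - 2^-1 = d / 2.
      by field.
    have d2 : d / 2 <= 2^-1 by lra.
    by have := cos2pi_le (normr_ge0 _) xd d2; lra.
  have qpN : q ^+ N <= peak d x ^+ N.
    by apply: lerXn2r => //; rewrite nnegrE; lra.
  have q0N : 0 <= q ^+ N by rewrite exprn_ge0//; lra.
  have ux : c <= u x by apply: ud; lra.
  by nra.
have key N : c * q ^+ N * d <= M.
  have cf : continuous (fun x => u x * peak d x ^+ N + M).
    apply: continuousDf; last exact: continuous_cstf.
    by apply: continuousMf => //; apply: continuousXf; exact: continuous_peak.
  have iI f : continuous f -> lebesgue_measure.-integrable I (EFin \o f).
    move=> cf'; apply: continuous_compact_integrable.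
      exact: segment_compact.
    exact: continuous_subspaceT.
  (* The wave of frequency and phase 0 is the constant 1. *)
  have E : mean (fun x => u x * peak d x ^+ N + M) = M.
    transitivity (mean (fun x => 1 * (u x * peak d x ^+ N * wave 0 0 x)
       + M * 1)).
      apply: eq_Rintegral => x _; rewrite /wave mulr0z mulr0 mul0r add0r cos0.
      by rewrite !mulr1 mul1r.
    rewrite (@mean_lin _ 1 M _ (fun=> 1)); last 2 first.
    + apply: continuousMf; last exact: continuous_wave.
      by apply: continuousMf => //; apply: continuousXf; exact: continuous_peak.
    + exact: continuous_cstf.
    rewrite orthogonal_peak// mulr0 add0r.
    rewrite Rintegral_cst//= lebesgue_measure_itv/=.
    by rewrite lte_fin ltr01 sube0/=; ring.
  have E2 : (\int[lebesgue_measure]_(x in I) (c * q ^+ N) = c * q ^+ N * d)%R.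
    have -> : d = fine (lebesgue_measure I).
      rewrite /I lebesgue_measure_itv/= lte_fin ifT; last by lra.
      by rewrite -EFinB/=; field.
    by rewrite Rintegral_cst.
  rewrite -E -E2.
  apply: (@le_trans _ _
    (\int[lebesgue_measure]_(x in I) (u x * peak d x ^+ N + M))%R).
    apply: le_Rintegral => //.
    - by apply: (iI (fun=> _)); exact: continuous_cstf.
    - exact: iI.
    - by move=> x Ix; apply: high; rewrite inE.
  apply: fine_le => //.
  - by apply: integrable_fin_num => //; exact: iI.
  - by apply: integrable_fin_num => //; exact: continuous_integrable01.
  - apply: ge0_subset_integral => //.
    + apply/measurable_EFinP; apply: measurable_funTS.
      exact: continuous_measurable_fun.
    + by move=> x x01; rewrite lee_fin low.
have e0 : 0 < c * d * (q - 1) by rewrite !mulr_gt0// subr_gt0.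
have := archi_boundP (divr_ge0 M0 (ltW e0)).
set N := Num.bound _; rewrite ltr_pdivrMr// => MN.
have := key N; have := bernoulli_inequality N (ltW q1).
have cd0 : 0 < c * d by rewrite mulr_gt0.
by nra.
Qed.

(** The previous lemma at an arbitrary point, by translation, and for both [u]
    and [- u]. *)
Lemma orthogonal_waves_eq0 (R : realType) (u : R -> R) :
  continuous u -> Zperiodic u -> orthogonal_waves u -> forall x, u x = 0.
Proof.
move=> cu pu ou x0.
have H (a : R) : a * u x0 <= 0.
  pose v x := a * u (x + (x0 - 2^-1)).
  have cv : continuous (fun x => u (x + (x0 - 2^-1))).
    move=> x; apply: continuous_comp; last exact: cu.
    by apply: cvgD; [exact: cvg_id|exact: cvg_cst].
  have -> : a * u x0 = v 2^-1 by rewrite /v addrC subrK.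
  apply: orthogonal_waves_center.
    by apply: continuousMf; [exact: continuous_cstf|exact: cv].
  move=> n th.
  pose w x := u x * wave n (th - 2 * pi * n%:~R * (x0 - 2^-1)) x.
  have cw : continuous w by apply: continuousMf => //; exact: continuous_wave.
  transitivity (mean (fun x => a * w (x + (x0 - 2^-1)))).
    apply: eq_Rintegral => x _; rewrite /v /w wave_shift subrK; ring.
  rewrite RintegralZl//; last first.
    apply: continuous_integrable01; apply: continuousMf => //.
    move=> x; apply: continuous_comp; last exact: continuous_wave.
    by apply: cvgD; [exact: cvg_id|exact: cvg_cst].
  rewrite mean_shift ?ou ?mulr0//.
  by move=> x m; rewrite /w pu wave_periodic.
by have := H 1; have := H (-1); lra.
Qed.

(** * Integration by parts and differentiation under the integral *)

Section DerivativeOperations.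
Context {R : realType}.
Implicit Types (u v : R -> R) (x a b : R).

Lemma is_deriveDf u v x a b : is_derive x 1 u a -> is_derive x 1 v b ->
  is_derive x 1 (fun t => u t + v t) (a + b).
Proof. by move=> du dv; have := is_deriveD du dv. Qed.

Lemma is_deriveMf u v x a b : is_derive x 1 u a -> is_derive x 1 v b ->
  is_derive x 1 (fun t => u t * v t) (u x * b + v x * a).
Proof. by move=> du dv; have := is_deriveM du dv. Qed.

Lemma is_deriveZf (k : R) u x a :
  is_derive x 1 u a -> is_derive x 1 (fun t => k * u t) (k * a).
Proof. by move=> du; have := is_deriveZ k du. Qed.

End DerivativeOperations.

Lemma is_derive_wave (R : realType) n (th x : R) :
  is_derive x 1 (wave n th) (2 * pi * n%:~R * wave n (th + pi / 2) x).
Proof.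
have -> : wave n (th + pi / 2) x = - sin (2 * pi * n%:~R * x + th).
  by rewrite /wave addrA cosDpihalf.
have dlin : is_derive x 1 (fun t => 2 * pi * n%:~R * t + th) (2 * pi * n%:~R).
  rewrite -[X in is_derive _ _ _ X]addr0 -[X in is_derive _ _ _ (X + _)]mulr1.
  exact: is_deriveDf (is_deriveZf _ (is_derive_id _ _)) (is_derive_cst _ _ _).
have dcos := is_derive_cos (2 * pi * n%:~R * x + th).
rewrite mulrC.
exact: (@is_derive1_comp R cos (fun t => 2 * pi * n%:~R * t + th) x _ _
  dcos dlin).
Qed.

Lemma wave_pi (R : realType) n (th x : R) : wave n (th + pi) x = - wave n th x.
Proof. by rewrite /wave addrA cosDpi. Qed.

Lemma is_derive_continuous (R : realType) (u u' : R -> R) :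
  (forall x : R, is_derive x 1 u (u' x)) -> continuous u.
Proof.
move=> du x; apply: differentiable_continuous; apply/derivable1_diffP.
by case: (du x).
Qed.

Lemma integral_derivative (R : realType) (u u' : R -> R) :
  (forall x : R, is_derive x 1 u (u' x)) -> continuous u' ->
  mean u' = u 1 - u 0.
Proof.
move=> du cu'; have cu := is_derive_continuous du.
rewrite /Rintegral (@continuous_FTC2 _ u' u 0 1)//.
- exact: continuous_subspaceT.
- split; first by move=> x _; case: (du x).
  + by apply: cvg_at_right_filter; exact: cu.
  + by apply: cvg_at_left_filter; exact: cu.
- by move=> x _; rewrite derive1E; exact: derive_val.
Qed.

(** Green's identity on a period: the boundary terms of u' w - u w' cancel by
    periodicity, and w'' = - (2 pi n)^2 w. *)
Lemma mean_second_derivative (R : realType) (u u1 u2 : R -> R) n th :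
  (forall x : R, is_derive x 1 u (u1 x)) ->
  (forall x : R, is_derive x 1 u1 (u2 x)) ->
  continuous u2 -> Zperiodic u -> Zperiodic u1 ->
  mean (fun x => u2 x * wave n th x)
    = - (2 * pi * n%:~R) ^+ 2 * mean (fun x => u x * wave n th x).
Proof.
move=> du du1 cu2 pu pu1.
have cu := is_derive_continuous du; have cu1 := is_derive_continuous du1.
set k := 2 * pi * n%:~R.
pose H x := u1 x * wave n th x - u x * (k * wave n (th + pi / 2) x).
pose H' x := 1 * (u2 x * wave n th x) + k ^+ 2 * (u x * wave n th x).
have dH (x : R) : is_derive x 1 H (H' x).
  have dw := is_derive_wave n th x.
  have dw1 := is_derive_wave n (th + pi / 2) x.
  have Epi : th + pi / 2 + pi / 2 = th + pi by field.
  rewrite Epi wave_pi in dw1.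
  have HE : H = fun t => u1 t * wave n th t
      + (-1) * (u t * (k * wave n (th + pi / 2) t)).
    by apply/funext => t; rewrite /H mulN1r.
  have := is_deriveDf (is_deriveMf (du1 x) dw)
    (is_deriveZf (-1) (is_deriveMf (du x) (is_deriveZf k dw1))).
  rewrite -HE => dHx; apply: is_derive_eq.
  rewrite /H' -/k; move: (wave n th x) (wave n (th + pi / 2) x) => a b.
  by ring.
have cuw : continuous (fun x => u x * wave n th x).
  by apply: continuousMf => //; exact: continuous_wave.
have cu2w : continuous (fun x => u2 x * wave n th x).
  by apply: continuousMf => //; exact: continuous_wave.
have cH' : continuous H'.
  by apply: continuousDf; apply: continuousMf => //; exact: continuous_cstf.
have := integral_derivative dH cH'.
have -> : H 1 - H 0 = 0.
  have E (v : R -> R) : Zperiodic v -> v 1 = v 0.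
    by move=> pv; rewrite -(pv 0 1) add0r.
  by rewrite /H !(E _ pu) !(E _ pu1) !(E _ (wave_periodic _ _)) subrr.
rewrite mean_lin// => HH.
by rewrite mulNr; lra.
Qed.

(** The integral of [F] over a period in its first variable. *)
Definition partial_mean {R : realType} (F : R * R -> R) (y : R) : R :=
  mean (fun x => F (x, y)).

Section ParametricMean.
Context {R : realType}.
Implicit Types F : R * R -> R.

Lemma continuous_slice1 F y : continuous F -> continuous (fun x => F (x, y)).
Proof.
move=> cF x; apply: (@continuous_comp _ _ _ (fun x => (x, y)) F).
  2: exact: cF.
exact: (cvg_pair cvg_id (cvg_cst _)).
Qed.

Lemma continuous_slice2 F x : continuous F -> continuous (fun y => F (x, y)).
Proof.
move=> cF y; apply: (@continuous_comp _ _ _ (fun y => (x, y)) F).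
  2: exact: cF.
exact: (cvg_pair (cvg_cst _) cvg_id).
Qed.

Lemma continuous_bounded_box F (a b : R) : continuous F ->
  exists M : R, forall x y, x \in `[0, 1] -> y \in `[a, b] -> `|F (x, y)| <= M.
Proof.
move=> cF.
have cK : compact (`[0, 1]%classic `*` `[a, b]%classic : set (R * R)).
  by apply: compact_setX; exact: segment_compact.
have cI : compact (F @` (`[0, 1]%classic `*` `[a, b]%classic)).
  by apply: continuous_compact => //; exact: continuous_subspaceT.
have [M [_ HM]] := compact_bounded cI.
exists (M + 1) => x y x01 yab; apply: (HM (M + 1)); first lra.
by exists (x, y).
Qed.

Lemma continuous_partial_mean F : continuous F -> continuous (partial_mean F).
Proof.
move=> cF y0.
have [M HM] := continuous_bounded_box (y0 - 1) (y0 + 1) cF.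
apply: (@continuity_under_integral R _ _ lebesgue_measure
  (fun y x => F (x, y)) `[0, 1]%classic _ (y0 - 1) (y0 + 1) _ _
  (fun=> M)) => //.
- by move=> y _; apply: continuous_integrable01; exact: continuous_slice1.
- by apply: aeW => x _ y _; exact: continuous_slice2.
- by apply: (@continuous_integrable01 R (fun=> M)); exact: continuous_cstf.
- move=> y yI; apply: aeW => x x01; apply: HM => //.
  exact: subset_itv_oo_cc.
- by rewrite inE/= in_itv/=; apply/andP; split; lra.
Qed.

Lemma is_derive_partial_mean F F2 : continuous F -> continuous F2 ->
  (forall x y : R, is_derive y 1 (fun t => F (x, t)) (F2 (x, y))) ->
  forall y : R, is_derive y 1 (partial_mean F) (partial_mean F2 y).
Proof.
move=> cF cF2 dF y0.
have [M HM] := continuous_bounded_box (y0 - 1) (y0 + 1) cF2.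
have E x y : partial1of2 (fun y x => F (x, y)) y x = F2 (x, y).
  by rewrite partial1of2E; exact: derive_val.
pose f := fun y x => F (x, y).
have m01 : measurable (`[0, 1]%classic : set R) by exact: measurable_itv.
have y0I : (`]y0 - 1, y0 + 1[%classic : set R) y0.
  by rewrite /= in_itv/=; apply/andP; split; lra.
have if' y : (`]y0 - 1, y0 + 1[%classic : set R) y ->
    lebesgue_measure.-integrable `[0, 1] (EFin \o f y).
  by move=> _; apply: continuous_integrable01; exact: continuous_slice1.
have df y x : (`]y0 - 1, y0 + 1[%classic : set R) y ->
    (`[0, 1]%classic : set R) x -> derivable (f ^~ x) y 1.
  by move=> _ _; case: (dF x y).
have M0 (x : R) : 0 <= `|M| by [].
have iM : lebesgue_measure.-integrable `[0, 1] (EFin \o fun=> `|M|).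
  by apply: (@continuous_integrable01 R (fun=> _)); exact: continuous_cstf.
have bM y x : (`]y0 - 1, y0 + 1[%classic : set R) y ->
    (`[0, 1]%classic : set R) x -> `|partial1of2 f y x| <= `|M|.
  move=> yI x01; rewrite E; apply: le_trans (ler_norm M); apply: HM => //.
  exact: subset_itv_oo_cc.
apply: DeriveDef.
  exact: (@derivable_under_integral R _ _ lebesgue_measure f _ m01 _ _ _ y0I
    if' df _ M0 iM bM).
rewrite -derive1E.
rewrite [LHS](@differentiation_under_integral R _ _ lebesgue_measure f _ m01
  _ _ _ y0I if' df _ M0 iM bM).
by apply: eq_Rintegral => x _; rewrite -E.
Qed.

End ParametricMean.

(** * Fourier coefficients on the plane *)

(** Functions on the plane that are invariant under the integer lattice. *)
Definition Zperiodic2 {R : realType} {T : Type} (F : R * R -> T) :=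
  forall x y (k l : int), F (x + k%:~R, y + l%:~R) = F (x, y).

Lemma Zperiodic2_slice1 (R : realType) (T : Type) (F : R * R -> T) y :
  Zperiodic2 F -> Zperiodic (fun x => F (x, y)).
Proof. by move=> pF x m; rewrite -[in RHS](pF x y m 0) addr0. Qed.

Lemma Zperiodic2_slice2 (R : realType) (T : Type) (F : R * R -> T) x :
  Zperiodic2 F -> Zperiodic (fun y => F (x, y)).
Proof. by move=> pF y m; rewrite -[in RHS](pF x y 0 m) addr0. Qed.

(** The Fourier coefficient in the first variable, as a function of the
    second one. *)
Definition partial_coef {R : realType} (F : R * R -> R) n th : R -> R :=
  partial_mean (fun p => F p * wave n th p.1).

(** The Fourier coefficient of frequency (n, m) and phases th, et, as an
    iterated integral. *)
Definition coef {R : realType} (F : R * R -> R) n th m et : R :=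
  mean (fun y => partial_coef F n th y * wave m et y).

Section Coefficients.
Context {R : realType}.
Implicit Types F G : R * R -> R.

Lemma continuous_mul_wave F n th : continuous F ->
  continuous (fun p => F p * wave n th p.1).
Proof.
move=> cF; apply: continuousMf => // p.
by apply: continuous_comp; [exact: cvg_fst|exact: continuous_wave].
Qed.

Lemma continuous_partial_coef F n th :
  continuous F -> continuous (partial_coef F n th).
Proof.
by move=> cF; apply: continuous_partial_mean; exact: continuous_mul_wave.
Qed.

Lemma partial_coef_periodic F n th :
  Zperiodic2 F -> Zperiodic (partial_coef F n th).
Proof.
move=> pF y m; apply: eq_Rintegral => x _ /=; congr (_ * _).
exact: (Zperiodic2_slice2 x pF).
Qed.

Lemma coef_eq0 F : continuous F -> Zperiodic2 F ->
  (forall n th m et, coef F n th m et = 0) -> forall p, F p = 0.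
Proof.
move=> cF pF c0 [x y].
apply: (@orthogonal_waves_eq0 R (fun x => F (x, y))).
- exact: continuous_slice1.
- exact: Zperiodic2_slice1.
- move=> n th.
  apply: (@orthogonal_waves_eq0 R (partial_coef F n th)).
  + exact: continuous_partial_coef.
  + exact: partial_coef_periodic.
  + by move=> m et; exact: c0.
Qed.

Lemma coef_shift F n th m et s t : continuous F -> Zperiodic2 F ->
  coef (fun p => F (p.1 + s, p.2 + t)) n th m et =
  coef F n (th - 2 * pi * n%:~R * s) m (et - 2 * pi * m%:~R * t).
Proof.
move=> cF pF.
have inner y : partial_coef (fun p => F (p.1 + s, p.2 + t)) n th y =
    partial_coef F n (th - 2 * pi * n%:~R * s) (y + t).
  rewrite /partial_coef /partial_mean /= -[RHS](@mean_shift R s).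
  - by apply: eq_Rintegral => x _; rewrite wave_shift subrK.
  - apply: continuousMf; last exact: continuous_wave.
    exact: continuous_slice1.
  - by move=> x k; rewrite wave_periodic (Zperiodic2_slice1 _ pF).
rewrite /coef -[RHS](@mean_shift R t).
- by apply: eq_Rintegral => y _; rewrite inner [in RHS]wave_shift subrK.
- apply: continuousMf; last exact: continuous_wave.
  exact: continuous_partial_coef.
- by move=> y k; rewrite wave_periodic partial_coef_periodic.
Qed.

Lemma coef_lin F G c n th m et : continuous F -> continuous G ->
  coef (fun p => F p + c * G p) n th m et =
  coef F n th m et + c * coef G n th m et.
Proof.
move=> cF cG.
have inner y : partial_coef (fun p => F p + c * G p) n th y =
    partial_coef F n th y + c * partial_coef G n th y.
  rewrite -[X in _ = X + _]mul1r -mean_lin.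
  - by apply: eq_Rintegral => x _ /=; ring.
  - exact: (continuous_slice1 (continuous_mul_wave cF)).
  - exact: (continuous_slice1 (continuous_mul_wave cG)).
rewrite -[X in _ = X + _]mul1r -mean_lin.
- by apply: eq_Rintegral => y _; rewrite inner; ring.
- apply: continuousMf; last exact: continuous_wave.
  exact: continuous_partial_coef.
- apply: continuousMf; last exact: continuous_wave.
  exact: continuous_partial_coef.
Qed.

Lemma coef_scale F n th th' m et et' (e1 e2 : R) : continuous F ->
  wave n th' =1 (fun x => e1 * wave n th x) ->
  wave m et' =1 (fun y => e2 * wave m et y) ->
  coef F n th' m et' = e1 * e2 * coef F n th m et.
Proof.
move=> cF H1 H2.
have inner y : partial_coef F n th' y = e1 * partial_coef F n th y.
  rewrite /partial_coef /partial_mean -RintegralZl//.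
    by apply: eq_Rintegral => x _ /=; rewrite H1; ring.
  apply: continuous_integrable01.
  exact: (continuous_slice1 (continuous_mul_wave cF)).
rewrite /coef -RintegralZl//.
  by apply: eq_Rintegral => y _; rewrite inner H2; ring.
apply: continuous_integrable01.
apply: continuousMf; last exact: continuous_wave.
exact: continuous_partial_coef.
Qed.

End Coefficients.

(** A periodic C^2 eigenfunction [f] of minus the Laplacian on the plane, with
    eigenvalue [mu], given with its partial derivatives up to the second order
    that the Laplacian involves. *)
Record C2_eigenfunction {R : realType} (f f1 f2 f11 f22 : R * R -> R) (mu : R)
  : Prop := C2Eigenfunction {
  eigen_cont : continuous f;
  eigen_cont1 : continuous f1;
  eigen_cont2 : continuous f2;
  eigen_cont11 : continuous f11;
  eigen_cont22 : continuous f22;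
  eigen_der1 : forall x y : R, is_derive x 1 (fun t => f (t, y)) (f1 (x, y));
  eigen_der11 : forall x y : R, is_derive x 1 (fun t => f1 (t, y)) (f11 (x, y));
  eigen_der2 : forall x y : R, is_derive y 1 (fun t => f (x, t)) (f2 (x, y));
  eigen_der22 : forall x y : R, is_derive y 1 (fun t => f2 (x, t)) (f22 (x, y));
  eigen_periodic : Zperiodic2 f;
  eigen_periodic1 : Zperiodic2 f1;
  eigen_periodic2 : Zperiodic2 f2;
  eigen_eq : forall p, - (f11 p + f22 p) = mu * f p }.

Section Eigenfunction.
Context {R : realType} (f f1 f2 f11 f22 : R * R -> R) (mu : R)
  (Hf : C2_eigenfunction f f1 f2 f11 f22 mu).

Lemma eigen_coef n th m et :
  ((2 * pi * n%:~R) ^+ 2 + (2 * pi * m%:~R) ^+ 2 - mu) * coef f n th m et = 0.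
Proof.
have [cf cf1 cf2 cf11 cf22 d1 d11 d2 d22 pf pf1 pf2 eqf] := Hf.
pose I := partial_coef f n th; pose I1 := partial_coef f2 n th.
pose I2 := partial_coef f22 n th.
have dI (y : R) : is_derive y 1 I (I1 y).
  apply: is_derive_partial_mean; [exact: continuous_mul_wave..|].
  move=> x t /=; rewrite mulrC.
  rewrite (_ : (fun t => _) = (fun t => wave n th x * f (x, t))).
    exact: is_deriveZf.
  by apply/funext => r; rewrite mulrC.
have dI1 (y : R) : is_derive y 1 I1 (I2 y).
  apply: is_derive_partial_mean; [exact: continuous_mul_wave..|].
  move=> x t /=; rewrite mulrC.
  rewrite (_ : (fun t => _) = (fun t => wave n th x * f2 (x, t))).
    exact: is_deriveZf.
  by apply/funext => r; rewrite mulrC.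
have I2E y : I2 y = ((2 * pi * n%:~R) ^+ 2 - mu) * I y.
  transitivity (mean (fun x => (- mu) * (f (x, y) * wave n th x)
      + (- 1) * (f11 (x, y) * wave n th x))).
    apply: eq_Rintegral => x _ /=; have := eqf (x, y).
    move: (wave _ _ _) (f11 _) (f22 _) (f _) => a b c d E.
    have -> : c = - (mu * d) - b by rewrite -E; ring.
    by ring.
  rewrite mean_lin; last 2 first.
  - exact: (continuous_slice1 (continuous_mul_wave cf)).
  - exact: (continuous_slice1 (continuous_mul_wave cf11)).
  rewrite (@mean_second_derivative R (fun x => f (x, y)) (fun x => f1 (x, y))
    (fun x => f11 (x, y)))//.
  - rewrite /I /partial_coef /partial_mean /=.
    by move: (\int[_]_(_ in _) _)%R (2 * _ * _) => a b; ring.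
  - exact: continuous_slice1.
  - exact: Zperiodic2_slice1.
  - exact: Zperiodic2_slice1.
have := @mean_second_derivative R I I1 I2 m et dI dI1
  (continuous_partial_coef cf22) (partial_coef_periodic _ _ pf)
  (partial_coef_periodic _ _ pf2).
have -> : mean (fun y => I2 y * wave m et y)
    = ((2 * pi * n%:~R) ^+ 2 - mu) * coef f n th m et.
  rewrite /coef -RintegralZl//.
    by apply: eq_Rintegral => y _; rewrite I2E mulrA.
  apply: continuous_integrable01.
  apply: continuousMf; last exact: continuous_wave.
  exact: continuous_partial_coef.
rewrite -/(coef f n th m et) => E.
by rewrite -addrA [_ ^+ 2 - mu]addrC addrA mulrDl E; ring.
Qed.

(** If a translation multiplies by [c] every wave product that may occur in
    [f], it multiplies [f] by [c]. *)
Lemma eigen_shift s t (c : R) :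
  (forall n m : int, (2 * pi * n%:~R) ^+ 2 + (2 * pi * m%:~R) ^+ 2 = mu ->
    exists e1 e2 : R, [/\ e1 * e2 = c,
      forall th, wave n (th - 2 * pi * n%:~R * s) =1 (fun x => e1 * wave n th x)
    & forall et, wave m (et - 2 * pi * m%:~R * t) =1
        (fun y => e2 * wave m et y)]) ->
  forall x y, f (x + s, y + t) = c * f (x, y).
Proof.
move=> H x y.
have cf := eigen_cont Hf; have pf := eigen_periodic Hf.
pose fs p := f (p.1 + s, p.2 + t).
have cfs : continuous fs.
  move=> p; apply: (@continuous_comp _ _ _
    (fun p : R * R => (p.1 + s, p.2 + t)) f); last exact: cf.
  apply: (cvg_pair (cvgD cvg_fst (cvg_cst _)) (cvgD cvg_snd (cvg_cst _))).
pose g p := fs p + (- c) * f p.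
have cg : continuous g.
  apply: continuousDf => //; apply: continuousMf => //.
  exact: continuous_cstf.
have pfs : Zperiodic2 fs.
  by move=> u v k l; rewrite /fs /= addrAC [v + _ + _]addrAC pf.
suff : g (x, y) = 0.
  by rewrite /g /fs /= mulNr => /eqP; rewrite subr_eq0 => /eqP.
apply: coef_eq0 => //.
  by move=> u v k l; rewrite /g pfs pf.
move=> n th m et; rewrite coef_lin// coef_shift//.
have [E|E] := eqVneq ((2 * pi * n%:~R) ^+ 2 + (2 * pi * m%:~R) ^+ 2) mu.
  have [e1 [e2 [<- H1 H2]]] := H n m E.
  by rewrite (coef_scale cf (H1 th) (H2 et)) mulNr subrr.
have Z th' et' : coef f n th' m et' = 0.
  have /eqP := eigen_coef n th' m et'.
  by rewrite mulf_eq0 subr_eq0 (negbTE E) => /eqP.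
by rewrite !Z mulr0 addr0.
Qed.

End Eigenfunction.

(** * The antisymmetric translation *)

Lemma int_parity (n : int) : exists a : int, n = 2 * a \/ n = 2 * a + 1.
Proof. exists (n %/ 2)%Z; lia. Qed.

(** One translation (s, t) makes exactly one of n s, m t an integer and the
    other half an odd integer, for all the frequencies (n, m) on the circle. *)
Lemma half_shift (R : realType) (N : nat) : (0 < N)%N ->
  exists s t : R, forall n m : int, n ^+ 2 + m ^+ 2 = N%:Z ->
  exists j l : int,
    (n%:~R * s = j%:~R /\ m%:~R * t = l%:~R + 2^-1) \/
    (n%:~R * s = j%:~R + 2^-1 /\ m%:~R * t = l%:~R).
Proof.
elim/ltn_ind: N => N IH N0.
have half (a : int) : (2 * a + 1)%:~R * 2^-1 = a%:~R + 2^-1 :> R.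
  by rewrite intrD intrM; move: (a%:~R : R) => r; field.
have whole (a : int) : (2 * a)%:~R * 2^-1 = a%:~R :> R.
  by rewrite intrM; move: (a%:~R : R) => r; field.
have [r [k [rk Nk]]] : exists r k : nat, (r < 4)%N /\ N = (4 * k + r)%N.
  by exists (N %% 4)%N, (N %/ 4)%N; lia.
case: (boolP (odd r)) => ro.
  (* N odd: exactly one of n, m is odd. *)
  exists 2^-1, 2^-1 => n m E.
  have [a [na|na]] := int_parity n; have [b [mb|mb]] := int_parity m.
  - exfalso; subst n m; nia.
  - by exists a, b; left; rewrite na mb half whole.
  - by exists a, b; right; rewrite na mb half whole.
  - exfalso; subst n m; nia.
have [r2|r0] : r = 2%N \/ r = 0%N by lia.
  (* N = 2 mod 4: n and m are odd. *)
  exists 2^-1, 0 => n m E.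
  have [a [na|na]] := int_parity n; have [b [mb|mb]] := int_parity m.
  - exfalso; subst n m r; nia.
  - exfalso; subst n m r; nia.
  - exfalso; subst n m r; nia.
  - by exists a, 0; right; rewrite na half mulr0.
(* N = 4 k: n and m are even, and n / 2, m / 2 lie on the circle for k. *)
have [||s [t H]] := IH k; [lia|lia|].
exists (s / 2), (t / 2) => n m E.
have [a na] : exists a, n = 2 * a.
  have [a [na|na]] := int_parity n; have [b [mb|mb]] := int_parity m;
    (by exists a) || (exfalso; subst n m r; nia).
have [b mb] : exists b, m = 2 * b.
  have [b [mb|mb]] := int_parity m; first by exists b.
  exfalso; subst n m r; nia.
have Eab : a ^+ 2 + b ^+ 2 = k%:Z by subst n m r; lia.
have E2 (c : int) (u : R) : (2 * c)%:~R * (u / 2) = c%:~R * u.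
  by rewrite intrM; move: (c%:~R : R) => v; field.
by have [j [l Hjl]] := H a b Eab; exists j, l; rewrite na mb !E2.
Qed.

Lemma wave_shift_int (R : realType) (n j : int) (s : R) th :
  n%:~R * s = j%:~R ->
  wave n (th - 2 * pi * n%:~R * s) =1 (fun x => 1 * wave n th x).
Proof.
move=> E x; rewrite mul1r /wave -[RHS](cosD2piz _ (- j)) mulrNz -E.
by congr cos; ring.
Qed.

Lemma wave_shift_half (R : realType) (n j : int) (s : R) th :
  n%:~R * s = j%:~R + 2^-1 ->
  wave n (th - 2 * pi * n%:~R * s) =1 (fun x => (- 1) * wave n th x).
Proof.
move=> E x.
rewrite mulN1r -wave_pi /wave -[RHS](cosD2piz _ (- (j + 1))) mulrNz intrD.
have -> : (j%:~R : R) = n%:~R * s - 2^-1 by rewrite E addrK.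
by congr cos; field.
Qed.

Lemma eigen_antisymmetry (R : realType) (f f1 f2 f11 f22 : R * R -> R) mu :
  C2_eigenfunction f f1 f2 f11 f22 mu ->
  (~ exists c, forall p, f p = c) ->
  exists s t, forall x y, f (x + s, y + t) = - f (x, y).
Proof.
move=> Hf ncst.
pose on_circle (n m : int) :=
  (2 * pi * n%:~R) ^+ 2 + (2 * pi * m%:~R) ^+ 2 = mu.
have [[n0 [m0 E0]]|none] := pselect (exists n m, on_circle n m); last first.
  (* No frequency is possible: f is zero, and any translation will do. *)
  exists 0, 0 => x y; rewrite -mulN1r.
  apply: (eigen_shift Hf) => n m E; exfalso; apply: none; by exists n, m.
have Emu (n m : int) : on_circle n m ->
    n ^+ 2 + m ^+ 2 = (absz (n0 ^+ 2 + m0 ^+ 2))%:Z.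
  move=> E; apply: (@eq_trans _ _ (n0 ^+ 2 + m0 ^+ 2)); last by nia.
  have pi0 : (2 * pi) ^+ 2 != 0 :> R.
    by rewrite expf_neq0// mulf_neq0// gt_eqF// pi_gt0.
  have : (2 * pi) ^+ 2 * (n ^+ 2 + m ^+ 2)%:~R
      = (2 * pi) ^+ 2 * (n0 ^+ 2 + m0 ^+ 2)%:~R :> R.
    have S (a b : int) : (2 * pi) ^+ 2 * (a ^+ 2 + b ^+ 2)%:~R
        = (2 * pi * a%:~R) ^+ 2 + (2 * pi * b%:~R) ^+ 2 :> R.
      by rewrite !intrD !rmorphXn !mulrDr -!exprMn.
    by rewrite !S E E0.
  by move=> /(mulfI pi0) /intr_inj.
have [N0|Npos] := posnP (absz (n0 ^+ 2 + m0 ^+ 2)).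
  (* N = 0: only the constant wave occurs, so f is invariant under every
     translation. *)
  exfalso; apply: ncst; exists (f (0, 0)) => -[x y].
  rewrite -[RHS]mul1r -[x]add0r -[y]add0r.
  apply: (eigen_shift Hf) => n m /Emu; rewrite N0 => E.
  have n_0 : n = 0 by nia.
  have m_0 : m = 0 by nia.
  exists 1, 1; rewrite mul1r; split=> // th; rewrite ?n_0 ?m_0.
  - by apply: (@wave_shift_int _ 0 0); rewrite mul0r.
  - by apply: (@wave_shift_int _ 0 0); rewrite mul0r.
have [s [t H]] := half_shift R Npos.
exists s, t => x y; rewrite -mulN1r.
apply: (eigen_shift Hf) => n m /Emu E.
have [j [l [[H1 H2]|[H1 H2]]]] := H n m E.
- exists 1, (-1); rewrite mul1r; split=> // th.
  + exact: wave_shift_int H1.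
  + exact: wave_shift_half H2.
- exists (-1), 1; rewrite mulr1; split=> // th.
  + exact: wave_shift_half H1.
  + exact: wave_shift_int H2.
Qed.

(** * From the torus to the plane *)

Section PartialDerivatives.
Context {R : realType}.
Implicit Types f : R * R -> R.

Lemma is_derive_partial1 f (x y : R) : derivable f (x, y) (1, 0) ->
  is_derive x 1 (fun t => f (t, y)) (partial1 f (x, y)).
Proof.
move=> df.
have E : (fun h : R => h^-1 *: (f (h *: 1 + x, y) - f (x, y)))
    = (fun h : R => h^-1 *: (f (h *: (1, 0) + (x, y)) - f (x, y))).
  apply/funext => h; congr (_ *: (f _ - _)).
  by congr pair; rewrite /= scaler0 add0r.
apply: DeriveDef; first by rewrite /derivable /= E; exact: df.
by rewrite /partial1 /derive /= E.
Qed.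

Lemma is_derive_partial2 f (x y : R) : derivable f (x, y) (0, 1) ->
  is_derive y 1 (fun t => f (x, t)) (partial2 f (x, y)).
Proof.
move=> df.
have E : (fun h : R => h^-1 *: (f (x, h *: 1 + y) - f (x, y)))
    = (fun h : R => h^-1 *: (f (h *: (0, 1) + (x, y)) - f (x, y))).
  apply/funext => h; congr (_ *: (f _ - _)).
  by congr pair; rewrite /= scaler0 add0r.
apply: DeriveDef; first by rewrite /derivable /= E; exact: df.
by rewrite /partial2 /derive /= E.
Qed.

Lemma derive_periodic f v : Zperiodic2 f -> Zperiodic2 (fun p => 'D_v f p).
Proof.
move=> pf x y k l; case: v => v1 v2; rewrite /derive.
have -> // : (fun h : R => h^-1 *: ((f \o shift (x + k%:~R, y + l%:~R))
      (h *: (v1, v2)) - f (x + k%:~R, y + l%:~R)))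
    = (fun h : R => h^-1 *: ((f \o shift (x, y)) (h *: (v1, v2)) - f (x, y))).
apply/funext => h; congr (_ *: (_ - _)); last exact: pf.
rewrite /= -[RHS](pf _ _ k l); congr (f _).
by congr pair; rewrite /= addrA.
Qed.

End PartialDerivatives.

Lemma torus_proj_periodic (R : realType) : Zperiodic2 (@torus_proj R).
Proof.
move=> x y k l; apply/eqquotP; rewrite /= /lattice_rel /=.
by rewrite !(addrAC _ _ (- _)) !subrr !add0r !intr_int.
Qed.

Lemma eigenfunction_lift (R : realType) (psi : torus R -> R) :
  real_eigenfunction psi ->
  let f := psi \o @torus_proj R in
  exists mu, C2_eigenfunction f (partial1 f) (partial2 f)
    (partial1 (partial1 f)) (partial2 (partial2 f)) mu.
Proof.
move=> [sf _ [mu Hmu]] f; exists mu.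
have pf : Zperiodic2 f.
  by move=> x y k l; rewrite /f /= torus_proj_periodic.
have /= [cf [d1 d2 D1 D2]] := sf 2%N.
have [cf1 [d11 _ [cf11 _] _]] := D1; have [cf2 [_ d22 _ [cf22 _]]] := D2.
apply: C2Eigenfunction.
- exact: cf.
- exact: cf1.
- exact: cf2.
- exact: cf11.
- exact: cf22.
- by move=> x y; exact: (is_derive_partial1 (d1 (x, y))).
- by move=> x y; exact: (is_derive_partial1 (d11 (x, y))).
- by move=> x y; exact: (is_derive_partial2 (d2 (x, y))).
- by move=> x y; exact: (is_derive_partial2 (d22 (x, y))).
- exact: pf.
- exact: derive_periodic pf.
- exact: derive_periodic pf.
- exact: Hmu.
Qed.

(** An open set of the plane is the countable union of the rational boxes that
    it contains. *)
Lemma open_measurable_plane (R : realType) (U : set (R * R)) :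
  open U -> measurable U.
Proof.
move=> oU.
pose box (q : (rat * rat) * (rat * rat)) : set (R * R) :=
  `]ratr q.1.1, ratr q.1.2[%classic `*` `]ratr q.2.1, ratr q.2.2[%classic.
pose F q := if `[< box q `<=` U >] then box q else set0.
have -> : U = \bigcup_q F q.
  apply/seteqP; split=> [[x y] Uxy|p [q _]]; last first.
    by rewrite /F; case: asboolP => // + qp; exact.
  have : nbhs (x, y) U by apply: open_nbhs_nbhs.
  move=> /nbhs_ballP[e /= e0 He].
  have [a] : exists a, ratr a \in `]x - e, x[ by apply: rat_in_itvoo; lra.
  have [b] : exists b, ratr b \in `]x, x + e[ by apply: rat_in_itvoo; lra.
  have [c] : exists c, ratr c \in `]y - e, y[ by apply: rat_in_itvoo; lra.
  have [d] : exists d, ratr d \in `]y, y + e[ by apply: rat_in_itvoo; lra.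
  rewrite !in_itv/= => /andP[d1 d2] /andP[c1 c2] /andP[b1 b2] /andP[a1 a2].
  exists ((a, b), (c, d)) => //; rewrite /F ifT.
    by split; rewrite /= in_itv/=; apply/andP.
  apply/asboolP => -[u v] [] /=; rewrite !in_itv/= => /andP[? ?] /andP[? ?].
  apply: He; split; rewrite /ball/= ltr_norml; apply/andP; split; lra.
apply: countable_bigcupT_measurable => // q.
rewrite /F; case: ifP => // _; apply: measurableX; exact: measurable_itv.
Qed.

(** * Volumes of periodic sets *)

Section Volume.
Context {R : realType}.
Local Notation mu := (@lebesgue_measure R).
Local Notation unit_itv := (`[0%R, 1%R[%classic : set R).
Implicit Types S : set (R * R).

(** The length of the vertical slice of [S] at x, over one period. *)
Definition slice_volume S (x : R) : \bar R :=
  mu (xsection (S `&` (setT `*` unit_itv)) x).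

Lemma volume_slices S : (mu \x mu)%E (S `&` (unit_itv `*` unit_itv))
  = (\int[mu]_(x in `[0%R, 1%R[) slice_volume S x)%E.
Proof.
rewrite /product_measure1 [RHS]integral_mkcond; apply: eq_integral => x _ /=.
rewrite patchE; case: ifPn => [xI|xI].
  congr (mu _); apply/seteqP; split => y /xsectionP /=.
    by move=> [Sxy [_ yI]]; apply/xsectionP.
  by move=> [Sxy [_ yI]]; apply/xsectionP; rewrite inE in xI.
rewrite (_ : xsection _ _ = set0) ?measure0//.
apply/seteqP; split => y // /xsectionP /= [_ [xI' _]].
by move/negP: xI; apply; rewrite inE.
Qed.

Lemma measurable_slice_volume S :
  measurable S -> measurable_fun [set: R] (slice_volume S).
Proof.
move=> mS; apply: measurable_fun_xsection; apply: measurableI => //.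
by apply: measurableX => //; exact: measurable_itv.
Qed.

Lemma slice_volumeE S x : measurable S ->
  slice_volume S x = (\int[mu]_(y in `[0%R, 1%R[) (\1_S (x, y))%:E)%E.
Proof.
move=> mS; have mSx : measurable (xsection S x) by exact: measurable_xsection.
transitivity (mu (xsection S x `&` unit_itv)).
  congr (mu _); apply/seteqP; split => y.
    by move=> /xsectionP [Sxy [_ yI]]; split => //; exact/xsectionP.
  by move=> [/xsectionP Sxy yI]; apply/xsectionP.
rewrite -integral_indic//; apply: eq_integral => y _.
by rewrite !indicE mem_xsection.
Qed.

(** Translation invariance of the volume of a periodic set [S'] over one period,
    first in the second variable slice by slice, then in the first variable. *)
Lemma volume_shift S S' (s t : R) : measurable S -> measurable S' ->
  (forall x y (k l : int), S' (x + k%:~R, y + l%:~R) <-> S' (x, y)) ->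
  (forall x y, S (x, y) <-> S' (x + s, y + t)) ->
  (mu \x mu)%E (S `&` (unit_itv `*` unit_itv))
  = (mu \x mu)%E (S' `&` (unit_itv `*` unit_itv)).
Proof.
move=> mS mS' pS' SS'.
have indicP (p q : R * R) (A B : set (R * R)) : (A p <-> B q) ->
    (\1_A p : R) = \1_B q.
  by move=> AB; rewrite !indicE; congr (_ %:R); congr nat_of_bool;
    apply/idP/idP; rewrite !inE => /AB.
have pI x : Zperiodic (fun y => (\1_S' (x, y))%:E : \bar R).
  move=> y m; congr EFin; apply: indicP.
  by rewrite -[X in S' (X, _)]addr0; exact: (pS' x y 0 m).
have mI x : measurable_fun [set: R] (fun y => (\1_S' (x, y))%:E : \bar R).
  apply/measurable_EFinP.
  by apply: (@measurableT_comp _ _ _ _ _ _ (\1_S' : R * R -> R) _ (pair x)).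
have sliceE x : slice_volume S x = slice_volume S' (x + s).
  rewrite !slice_volumeE// -[RHS](@ge0_integral_periodic_shift _ t)//.
  by apply: eq_integral => y _; congr EFin; exact: indicP.
rewrite !volume_slices -[RHS](@ge0_integral_periodic_shift _ s)//.
- by apply: eq_integral => x _; rewrite sliceE.
- exact: measurable_slice_volume.
- move=> x m; rewrite !slice_volumeE//; apply: eq_integral => y _.
  congr EFin; apply: indicP.
  by rewrite -[X in S' (_, X)]addr0; exact: (pS' x y m 0).
Qed.

End Volume.

Theorem theorem2p1 (R : realType) (psi : torus R -> R)
  (psi_eigen : real_eigenfunction psi)
  (psi_nonconst : ~ exists c : R, forall x : torus R, psi x = c) :
  torus_vol [set x | 0 < psi x] = torus_vol [set x | psi x < 0].
Proof.
have [mu Hf] := eigenfunction_lift psi_eigen.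
set f := psi \o @torus_proj R in Hf.
have cf := eigen_cont Hf.
have [|s [t anti]] := eigen_antisymmetry Hf.
  move=> [c fc]; apply: psi_nonconst; exists c => q.
  by rewrite -[q]reprK; exact: fc.
have opos : open (f @^-1` [set r | 0 < r]).
  by apply: open_comp; [move=> p _; exact: cf|exact: open_gt].
have oneg : open (f @^-1` [set r | r < 0]).
  by apply: open_comp; [move=> p _; exact: cf|exact: open_lt].
apply: (@volume_shift _ _ _ s t).
- exact: open_measurable_plane opos.
- exact: open_measurable_plane oneg.
- move=> x y k l; change (f (x + k%:~R, y + l%:~R) < 0 <-> f (x, y) < 0).
  by rewrite (eigen_periodic Hf).
- move=> x y; change (0 < f (x, y) <-> f (x + s, y + t) < 0).
  by rewrite anti oppr_lt0.
Qed.
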